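(* Let $\mathscr{A}$ be a nonempty family of infinite real matrices $A=(a_{n,k}:n,k\in\omega)$ such that $\sup\{\|A\|:A\in\mathscr{A}\}<\infty$, where $\|A\|:=\sup_n\sum_k|a_{n,k}|$. Let $\mathcal{I}$ be an ideal on $\omega$. Then $$\forall\bm{x}\in\ell_\infty,\quad\mathcal{I}\text{-}\limsup_{n\to\infty}\ \sup_{A\in\mathscr{A}}A_n\bm{x}=\sup_{B\in\mathscr{B}_{\mathscr{A}}}\ \mathcal{I}\text{-}\limsup_{n\to\infty}B_n\bm{x}.$$
   Context: $\omega=\{0,1,2,\ldots\}$; $\ell_\infty$ is the space of bounded real sequences. For a real matrix $A=(a_{n,k})$ with $\|A\|<\infty$ and $\bm{x}=(x_k)\in\ell_\infty$, $A_n\bm{x}:=\sum_ka_{n,k}x_k$. $\mathscr{B}_{\mathscr{A}}$ is the set of all real matrices $B=(b_{n,k}:n,k\in\omega)$ such that for every $n\in\omega$ there exists $A\in\mathscr{A}$ (depending on $n$) with $b_{n,k}=a_{n,k}$ for all $k\in\omega$. An ideal on $\omega$ is a family $\mathcal{I}$ of subsets of $\omega$ closed under finite unions and subsets; it is always assumed that $\omega\notin\mathcal{I}$ and that $\mathcal{I}$ contains all finite subsets of $\omega$. For a bounded real sequence $\bm{y}=(y_n)$, a real $\eta$ is an $\mathcal{I}$-cluster point of $\bm{y}$ if $\{n\in\omega:|y_n-\eta|\le\varepsilon\}\notin\mathcal{I}$ for all $\varepsilon>0$. The set $\Gamma_{\bm{y}}(\mathcal{I})$ of $\mathcal{I}$-cluster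 points is nonempty and compact, and $\mathcal{I}\text{-}\limsup\bm{y}:=\max\Gamma_{\bm{y}}(\mathcal{I})$. *)

(* Defs.v *)
From mathcomp Require Import all_boot all_order all_algebra.
From mathcomp Require Import all_classical all_reals all_analysis.
Import Order.TTheory GRing.Theory Num.Theory numFieldNormedType.Exports.

Set Implicit Arguments.
Unset Strict Implicit.
Unset Printing Implicit Defensive.

Local Open Scope classical_set_scope.
Local Open Scope ring_scope.

Definition infmatrix (R : Type) := nat -> nat -> R.

Record is_ideal (I : set (set nat)) : Prop := IsIdeal {
  ideal_setU : forall S T, I S -> I T -> I (S `|` T);
  ideal_sub : forall S T, S `<=` T -> I T -> I S;
  ideal_finite : forall S, finite_set S -> I S;
  ideal_proper : ~ I setT }.

Section Definitions.
Variable R : realType.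
Implicit Types (A B : infmatrix R) (cA : set (infmatrix R)) (x y : nat -> R)
  (I : set (set nat)).

Definition infmx_norm A : \bar R :=
  ereal_sup (range (fun n => (\sum_(0 <= k <oo) `|A n k|%:E)%E)).

Definition infmx_app A x (n : nat) : R := limn [series A n k * x k]_k.

Definition row_selections cA : set (infmatrix R) :=
  [set B | forall n, exists2 A, cA A & forall k, B n k = A n k].

Definition ideal_cluster I y : set R :=
  [set eta | forall e : R, 0 < e -> ~ I [set n | `|y n - eta| <= e]].

(* The largest cluster point. The default value 0 is irrelevant for bounded
   sequences, see ideal_limsup_max. *)
Definition ideal_limsup I y : R :=
  xget 0 (ideal_cluster I y `&` ubound (ideal_cluster I y)).

Lemma ideal_limsup_max I y : is_ideal I -> bounded_fun y ->
  ideal_cluster I y (ideal_limsup I y) /\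
  ubound (ideal_cluster I y) (ideal_limsup I y).
Proof.
move=> idI [M [_ yM]].
have {}yM n : `|y n| <= M + 1 by apply: (yM (M + 1)) => //; rewrite ltrDl.
pose S : set R := [set t | ~ I [set n | t <= y n]].
have S0 : S !=set0.
  exists (- (M + 1)) => IS; apply: (ideal_proper idI).
  apply: (ideal_sub idI _ IS) => n _ /=.
  by have := yM n; rewrite ler_norml => /andP[].
have Sub : has_ubound S.
  exists (M + 1) => t St; rewrite leNgt; apply/negP => tM; apply: St.
  apply: (ideal_finite idI); rewrite (_ : [set n | _] = set0)//.
  rewrite -subset0 => n /= tyn; have := le_trans tyn (ler_norm _).
  by move=> /le_trans/(_ (yM n)); rewrite leNgt tM.
suff : (ideal_cluster I y `&` ubound (ideal_cluster I y)) (sup S).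
  by move=> supP; have [] := xgetI 0 supP.
split=> [e e0 Ie|eta eta_cl].
  have [t St stt] := sup_adherent e0 (conj S0 Sub).
  apply: St.
  have Ise : I [set n | sup S + e <= y n].
    apply: contrapT => /(ub_le_sup Sub); rewrite leNgt ltrDl e0.
    exact.
  apply: (ideal_sub idI _ (ideal_setU idI Ie Ise)) => n /= tyn.
  have [yse|yse] := leP (sup S + e) (y n); [by right|left].
  rewrite ler_norml lerBlDl (ltW yse) andbT lerBrDl.
  exact: le_trans (ltW stt) tyn.
apply/ler_addgt0Pr => e e0; rewrite -lerBlDr; apply: ub_le_sup => // Ie.
apply: (eta_cl e e0); apply: (ideal_sub idI _ Ie) => n /=.
by rewrite ler_norml lerBrDl => /andP[].
Qed.

End Definitions.

(* Main.v *)
Require Import Defs.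
From mathcomp Require Import all_boot all_order all_algebra.
From mathcomp Require Import all_classical all_reals all_analysis.
From mathcomp Require Import lra.
Import Order.TTheory GRing.Theory Num.Theory numFieldNormedType.Exports.

Local Open Scope classical_set_scope.
Local Open Scope ring_scope.

(** Up to a uniform error [e], a selection of rows realises the supremum of
    [A_n x] for all [n] at once, so the theorem reduces to monotonicity of the
    ideal limsup up to a uniform error. The latter rests on the fact that the
    limsup of [y] exceeds every [t] with [{n | t <= y n}] outside the ideal. *)

(** Passing to this ideal restricts attention to indices in [T]; it is proper precisely because [T]
    lies outside [I]. *)
Lemma is_ideal_trace (I : set (set nat)) (T : set nat) : is_ideal I -> ~ I T ->
  is_ideal [set S | I (S `&` T)].
Proof.
move=> idI IT; split => /=.
- by move=> S U IS IU; rewrite setIUl; exact: ideal_setU.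
- by move=> S U SU; apply: (ideal_sub idI); exact: setSI.
- by move=> S fS; apply: (ideal_finite idI); exact: finite_setIl.
- by rewrite setTI.
Qed.

Section IdealLimsup.
Context {R : realType}.
Implicit Types (I : set (set nat)) (x y z : nat -> R).

Lemma bounded_fun_le y (C : R) : (forall n, `|y n| <= C) -> bounded_fun y.
Proof.
by move=> yC; exists C; split; [exact: num_real|move=> D CD n _; exact: le_trans (yC n) (ltW CD)].
Qed.

Lemma ideal_limsup_ge I y (t : R) : is_ideal I -> bounded_fun y ->
  ~ I [set n | t <= y n] -> t <= ideal_limsup I y.
Proof.
move=> idI by_ It.
(* A cluster point along the trace of [I] on [{t <= y}] is at least [t], and it
   is a cluster point along [I]. *)
have [Lcl _] := ideal_limsup_max (is_ideal_trace _ _ idI It) by_.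
set L := ideal_limsup _ y in Lcl.
have tL : t <= L.
  rewrite leNgt; apply/negP => Lt.
  (* With half the gap as radius, no [y n] near [L] reaches [t], so the trace on [T] is empty. *)
  have e0 : 0 < (t - L) / 2 by lra.
  apply: (Lcl _ e0); apply: (ideal_sub idI _ (ideal_finite idI (finite_set0 nat))).
  by move=> n /= [+ tn]; rewrite ler_norml => /andP[_ ?]; lra.
apply: (le_trans tL); have [_ ] := ideal_limsup_max idI by_; apply => e e0 Ie.
by apply: (Lcl _ e0); apply: (ideal_sub idI _ Ie) => n [].
Qed.

(** Since the limsup of [y] is a cluster point, [y] stays within [d] of it on a set outside [I]. On
    that set [z] is at least this limsup minus [d + e], so [ideal_limsup_ge] applies to [z]. *)
Lemma ideal_limsup_le I y z (e : R) : is_ideal I ->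
  bounded_fun y -> bounded_fun z -> (forall n, y n <= z n + e) ->
  ideal_limsup I y <= ideal_limsup I z + e.
Proof.
move=> idI by_ bz yz; have [Lcl _] := ideal_limsup_max idI by_.
apply/ler_addgt0Pr => d d0.
suff : ideal_limsup I y - d - e <= ideal_limsup I z by lra.
apply: ideal_limsup_ge => // Iz; apply: (Lcl _ d0).
apply: (ideal_sub idI _ Iz) => n /=; rewrite ler_norml => /andP[? _].
by have := yz n; lra.
Qed.

End IdealLimsup.

Section MatrixBounds.
Context {R : realType}.
Implicit Types (a x : nat -> R) (A : infmatrix R) (cA : set (infmatrix R)).

Lemma norm_limn_series_le a x (K M : R) : (forall k, `|x k| <= M) ->
  (\sum_(0 <= k <oo) `|a k|%:E <= K%:E)%E ->
  `|limn [series a k * x k]_k| <= K * M.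
Proof.
move=> xM aK.
have M0 : 0 <= M by exact: le_trans (normr_ge0 _) (xM 0%N).
have partial n : \sum_(0 <= k < n) `|a k * x k| <= K * M.
  have aKn : \sum_(0 <= k < n) `|a k| <= K.
    rewrite -lee_fin -sumEFin; apply: le_trans aK.
    by apply: nneseries_lim_ge => k _ _; rewrite lee_fin.
  apply: (le_trans _ (ler_wpM2r M0 aKn)); rewrite mulr_suml.
  by apply: ler_sum => k _; rewrite normrM ler_wpM2l.
(* Absolute convergence ensures that [limn] is a genuine limit and not a default value. *)
have cvgN : cvgn [normed [series a k * x k]_k].
  apply: nondecreasing_is_cvgn.
    by apply: (nondecreasing_series (P := xpredT)) => k _ _; exact: normr_ge0.
  by exists (K * M) => _ [n _ <-]; exact: partial.
apply: (le_trans (lim_series_norm cvgN)); apply: limr_le => //.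
by apply: nearW => n; exact: partial.
Qed.

Lemma infmx_row_bound cA : cA !=set0 ->
  (ereal_sup [set infmx_norm A | A in cA] < +oo)%E ->
  exists K : R, forall A n, cA A -> (\sum_(0 <= k <oo) `|A n k|%:E <= K%:E)%E.
Proof.
move=> [A0 cA0] fin; set s := ereal_sup _ in fin.
have le_s A n : cA A -> (\sum_(0 <= k <oo) `|A n k|%:E <= s)%E.
  move=> cAA; apply: (@le_trans _ _ (infmx_norm A)).
    by apply: ereal_sup_ubound; exists n.
  by apply: ereal_sup_ubound; exists A.
(* Together with [fin] this makes [s] finite, so that [fine s] is its true value; a row of [A0]
   rules out [-oo]. *)
have s0 : (0 <= s)%E.
  by apply: le_trans (le_s A0 0%N cA0); apply: nneseries_ge0 => k _ _; rewrite lee_fin.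
by exists (fine s) => A n cAA; rewrite fineK ?le_s// ge0_fin_numE.
Qed.

Lemma infmx_app_bound cA x : cA !=set0 ->
  (ereal_sup [set infmx_norm A | A in cA] < +oo)%E -> bounded_fun x ->
  exists C : R, forall A n, cA A -> `|infmx_app A x n| <= C.
Proof.
move=> cA0 fin [M [_ xM]]; have [K AK] := infmx_row_bound _ cA0 fin.
exists (K * (M + 1)) => A n cAA; apply: norm_limn_series_le; last exact: AK.
by move=> k; apply: (xM (M + 1)) => //; rewrite ltrDl.
Qed.

Lemma row_selection_app cA (n : nat) x B : row_selections cA B ->
  exists2 A, cA A & infmx_app B x n = infmx_app A x n.
Proof.
move=> /(_ n)[A' cA' BA]; exists A' => //; rewrite /infmx_app.
by under eq_fun do rewrite BA.
Qed.

End MatrixBounds.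

Theorem proposition2p10 (R : realType) (cA : set (infmatrix R))
    (I : set (set nat)) :
  cA !=set0 ->
  (ereal_sup [set infmx_norm A | A in cA] < +oo)%E ->
  is_ideal I ->
  forall x : nat -> R, bounded_fun x ->
    ideal_limsup I (fun n => sup [set infmx_app A x n | A in cA]) =
    sup [set ideal_limsup I (infmx_app B x) | B in row_selections cA].
Proof.
move=> cA0 fin idI x bx; have [C AC] := infmx_app_bound _ _ cA0 fin bx.
set s := fun n => sup _.
(* The real [sup] is meaningful only for nonempty sets that are bounded above. *)
have Asup n : has_sup [set infmx_app A x n | A in cA].
  split; first by have [A cAA] := cA0; exists (infmx_app A x n); exists A.
  by exists C => _ [A cAA <-]; exact: le_trans (ler_norm _) (AC A n cAA).
have As A n : cA A -> infmx_app A x n <= s n.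
  by move=> cAA; apply: ub_le_sup; [exact: (Asup n).2|exists A].
have bs : bounded_fun s.
  apply: (bounded_fun_le _ C) => n; rewrite ler_norml; apply/andP; split.
    have [A cAA] := cA0; apply: le_trans (As A n cAA).
    by have := AC A n cAA; rewrite ler_norml => /andP[].
  apply: ge_sup; first exact: (Asup n).1.
  by move=> _ [A cAA <-]; exact: le_trans (ler_norm _) (AC A n cAA).
have bB B : row_selections cA B -> bounded_fun (infmx_app B x).
  move=> selB; apply: (bounded_fun_le _ C) => n.
  by have [A cAA ->] := row_selection_app _ n x _ selB; exact: AC.
have Bs B : row_selections cA B ->
    ideal_limsup I (infmx_app B x) <= ideal_limsup I s.
  move=> selB; rewrite -[leRHS]addr0; apply: ideal_limsup_le => //; first exact: bB.
  by move=> n; have [A cAA ->] := row_selection_app _ n x _ selB; rewrite addr0 As.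
apply/eqP; rewrite eq_le; apply/andP; split; last first.
  apply: ge_sup; last by move=> _ [B selB <-]; exact: Bs.
  (* Any member of [cA] is itself a row selection, so the supremum on the right is over a nonempty
     set. *)
  have [A cAA] := cA0; exists (ideal_limsup I (infmx_app A x)); exists A => //.
  by move=> n; exists A.
apply/ler_addgt0Pr => e e0.
have near_sup n : exists A, cA A /\ s n <= infmx_app A x n + e.
  have [_ [A cAA <-] lt_sA] := sup_adherent e0 (Asup n).
  by exists A; split=> //; rewrite -lerBlDr ltW.
(* Diagonal choice: row [n] of [B] is row [n] of a matrix [F n] that is within [e] of the supremum
   at [n]. *)
have [F Fs] := choice near_sup; pose B : infmatrix R := fun n => F n n.
have selB : row_selections cA B by move=> n; exists (F n) => //; case: (Fs n).
apply: (@le_trans _ _ (ideal_limsup I (infmx_app B x) + e)).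
  by apply: ideal_limsup_le => //; [exact: bB|move=> n; case: (Fs n)].
rewrite lerD2r; apply: ub_le_sup; last by exists B.
by exists (ideal_limsup I s) => _ [B' selB' <-]; exact: Bs.
Qed.
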